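(* Let $(X,d)$ be a compact metric space and let $m\ge 2$. Let $f:X\to X$ be a continuous map and let $A=(a_{ij})$ be an irreducible $m\times m$ transition matrix such that there exists an index $i_0$ with $\sum_{j=1}^m a_{i_0 j}\ge 2$. Let $V_1,\dots,V_m$ be compact subsets of $X$ such that $f$ is strictly $A$-coupled-expanding in $V_i$ ($1\le i\le m$). If there exists an $\alpha=(a_0a_1\ldots)\in\Sigma_A$ such that $$V_\alpha=\bigcap_{n=0}^\infty f^{-n}(V_{a_n})$$ is a singleton, then there exists an increasing sequence $(p_k)$ of positive integers such that $f$ is distributionally chaotic in the sequence $(p_k)$.
   Context: Transition matrix: an $m\times m$ matrix $A=(a_{ij})$ is a transition matrix if $a_{ij}\in\{0,1\}$ for all $i,j$, $\sum_{j=1}^m a_{ij}\ge 1$ for every $i$, and $\sum_{i=1}^m a_{ij}\ge 1$ for every $j$. It is irreducible if for every pair $1\le i,j\le m$ there is an integer $k\ge 1$ such that the $(i,j)$ entry of $A^k$ is positive. Symbol space: $\mathbb{N}_0=\{0,1,2,\dots\}$ and $\Sigma_A=\{(b_0b_1\ldots) : b_i\in\{1,\dots,m\},\ a_{b_ib_{i+1}}=1 \text{ for all } i\in\mathbb{N}_0\}$, the set of one-sided infinite sequences admissible for $A$. $f^0$ is the identity map. Strictly $A$-coupled-expanding: $f$ is $A$-coupled-expanding in $V_1,\dots,V_m$ if the $V_i$ are nonempty subsets with pairwise disjoint interiors and $f(V_i)\supset\bigcup_{j:\,a_{ij}=1}V_j$ for all $1\le i\le m$. It is strictly $A$-coupled-expanding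 in $V_1,\dots,V_m$ if moreover $d(V_i,V_j)=\inf\{d(x,y):x\in V_i,y\in V_j\}>0$ for all $1\le i\ne j\le m$. Distributional chaos in a sequence: let $(p_k)$ be an increasing sequence of positive integers. For $x,y\in X$ and $t>0$ set $$F_{xy}(t,(p_k))=\liminf_{n\to\infty}\frac1n\#\{k: d(f^{p_k}(x),f^{p_k}(y))<t,\ 1\le k\le n\},$$ $$F^*_{xy}(t,(p_k))=\limsup_{n\to\infty}\frac1n\#\{k: d(f^{p_k}(x),f^{p_k}(y))<t,\ 1\le k\le n\}.$$ A subset $D\subset X$ is a distributionally chaotic set in the sequence $(p_k)$ if for any $x,y\in D$ with $x\ne y$: (1) there is an $\varepsilon>0$ with $F_{xy}(\varepsilon,(p_k))=0$, and (2) $F^*_{xy}(t,(p_k))=1$ for every $t>0$. The map $f$ is distributionally chaotic in the sequence $(p_k)$ if it has an uncountable distributionally chaotic set in the sequence $(p_k)$. *)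

(* Defs.v *)
From mathcomp Require Import all_boot all_order all_algebra.
From mathcomp Require Import all_classical all_reals all_analysis.

Set Implicit Arguments.
Unset Strict Implicit.
Unset Printing Implicit Defensive.

Import Order.TTheory GRing.Theory Num.Theory.

Local Open Scope classical_set_scope.
Local Open Scope ring_scope.

Definition transition_matrix (m : nat) (A : 'M[nat]_m) : Prop :=
  [/\ forall i j, A i j = 0%N \/ A i j = 1%N,
      forall i, (1 <= \sum_j A i j)%N
    & forall j, (1 <= \sum_i A i j)%N].

Definition irreducible_mx (m : nat) (A : 'M[nat]_m) : Prop :=
  forall i j, exists2 k, (1 <= k)%N & (0 < (A ^+ k) i j)%N.

(* Symbols are numbered 0, ..., m - 1 instead of 1, ..., m. *)
Definition symbol_space (m : nat) (A : 'M[nat]_m) : set (nat -> 'I_m) :=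
  [set b | forall i, A (b i) (b i.+1) = 1%N].

Definition set_dist (R : realType) (X : metricType R) (U V : set X) : R :=
  inf [set mdist x y | x in U & y in V].

Definition coupled_expanding (R : realType) (X : metricType R) (f : X -> X)
    (m : nat) (A : 'M[nat]_m) (V : 'I_m -> set X) : Prop :=
  [/\ forall i, V i !=set0,
      forall i j, i != j -> (V i)° `&` (V j)° = set0
    & forall i, \bigcup_(j in [set j | A i j = 1%N]) V j `<=` f @` V i].

Definition strictly_coupled_expanding (R : realType) (X : metricType R)
    (f : X -> X) (m : nat) (A : 'M[nat]_m) (V : 'I_m -> set X) : Prop :=
  coupled_expanding f A V /\ forall i j, i != j -> 0 < set_dist (V i) (V j).

Definition itinerary_set (X : Type) (f : X -> X) (m : nat)
    (V : 'I_m -> set X) (a : nat -> 'I_m) : set X :=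
  \bigcap_n (iter n f @^-1` V (a n)).

(* Sequences of times are indexed from 0: the term p_k (k >= 1) of the usual
   notation is p k.-1, so that 1 <= k <= n becomes k < n. At n = 0 the frequency
   is 0 / 0 = 0, which affects neither the limit inferior nor the limit
   superior. *)
Definition proximity_freq (R : realType) (X : metricType R) (f : X -> X)
    (p : nat -> nat) (x y : X) (t : R) (n : nat) : R :=
  #|[set k : 'I_n | mdist (iter (p k) f x) (iter (p k) f y) < t]%SET|%:R
    / n%:R.

Definition lower_dist (R : realType) (X : metricType R) (f : X -> X)
    (p : nat -> nat) (x y : X) (t : R) : R :=
  limn_inf (proximity_freq f p x y t).

Definition upper_dist (R : realType) (X : metricType R) (f : X -> X)
    (p : nat -> nat) (x y : X) (t : R) : R :=
  limn_sup (proximity_freq f p x y t).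

Definition dist_chaotic_set (R : realType) (X : metricType R) (f : X -> X)
    (p : nat -> nat) (D : set X) : Prop :=
  forall x y, D x -> D y -> x <> y ->
    (exists2 e : R, 0 < e & lower_dist f p x y e = 0) /\
    (forall t : R, 0 < t -> upper_dist f p x y t = 1).

Definition dist_chaotic (R : realType) (X : metricType R) (f : X -> X)
    (p : nat -> nat) : Prop :=
  exists2 D : set X, ~ countable D & dist_chaotic_set f p D.

(* Main.v *)
(* Fix a vertex i0 with two distinct successors j1, j2 and loops c1, c2 at i0
   through them. A bit sequence s is coded by an infinite concatenation of loops
   at i0, each sampled at one time p_k: the k-th loop either contains
   a_0 ... a_k starting at time p_k, or is c1 c2 or c2 c1 according to a bit s_c,
   with the first letter (j1 or j2) at time p_k. The length of a loop does not
   depend on s, so neither does p_k. In the first case the orbits coded by any s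
   and s' are close at time p_k for k large, because V_a is a singleton; in the
   second case they are at distance at least d(V_j1, V_j2) when s_c <> s'_c.
   The kind of loop used at k is arranged so that each kind has upper density 1. *)
Require Import Defs.
From mathcomp Require Import all_boot all_order all_algebra.
From mathcomp Require Import all_classical all_reals all_analysis.
From mathcomp Require Import zify.

Set Implicit Arguments.
Unset Strict Implicit.
Unset Printing Implicit Defensive.

Import Order.TTheory GRing.Theory Num.Theory.

Local Open Scope classical_set_scope.
Local Open Scope ring_scope.

(** * Concatenation of words and the schedule of loop kinds *)

(** A word omits its starting vertex [i0] and ends there, so consecutive words chain into one path.
    The construction puts [i0] itself at position 0, whence the shift by one in the positions. *)
Lemma concat_words (T : Type) (e : rel T) (i0 : T) (len : nat -> nat)
    (w : nat -> seq T) :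
  (forall k, 0 < len k)%N -> (forall k, size (w k) = len k) ->
  (forall k, path e i0 (w k)) -> (forall k, last i0 (w k) = i0) ->
  exists2 b : nat -> T, forall n, e (b n) (b n.+1) &
    forall k j, (j < len k)%N ->
      b (\sum_(l < k) len l + j).+1 = nth i0 (w k) j.
Proof.
move=> len_gt0 szw pw lw.
pose L k := flatten (mkseq w k).
have LS k : L k.+1 = L k ++ w k by rewrite /L mkseqS flatten_rcons.
have szL k : size (L k) = (\sum_(l < k) len l)%N.
  by elim: k => [|k IH]; rewrite ?big_ord0 // LS size_cat IH szw big_ord_recr.
have lL k : last i0 (L k) = i0.
  by elim: k => [//|k IH]; rewrite LS last_cat IH lw.
have pL k : path e i0 (L k).
  by elim: k => [//|k IH]; rewrite LS cat_path IH lL pw.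
have leL k : (k <= size (L k))%N.
  elim: k => [//|k IH]; rewrite LS size_cat szw.
  by have := len_gt0 k; lia.
have stable n k i : (n <= k)%N -> (i <= size (L n))%N ->
    nth i0 (i0 :: L k) i = nth i0 (i0 :: L n) i.
  move=> nk iL; rewrite -(subnKC nk); elim: (k - n)%N => [|d IH].
    by rewrite addn0.
  rewrite addnS LS -cat_cons nth_cat IH /= ltnS ifT //.
  have szm d' : (size (L n) <= size (L (n + d')))%N.
    elim: d' => [|d' IHd]; first by rewrite addn0.
    by rewrite addnS LS size_cat; lia.
  exact: leq_trans iL (szm d).
(* A diagonal limit: [L n] has at least [n] letters, so entry [n] is final by stage [n]. *)
pose b n := nth i0 (i0 :: L n) n.
have bE n i : (i <= size (L n))%N -> b i = nth i0 (i0 :: L n) i.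
  move=> iL; case/orP: (leq_total i n) => h.
    by rewrite (stable i n i).
  by rewrite /b (stable n i i).
exists b => [n|k j jk].
  rewrite (bE n.+1 n) ?(bE n.+1 n.+1) //; last exact: ltnW (leL n.+1).
  exact: (pathP i0 (pL n.+1)).
rewrite (bE k.+1) LS; last by rewrite size_cat szw szL; lia.
by rewrite /= nth_cat szL ltnNge leq_addr /= addKn.
Qed.

Lemma exists_dense_values : exists T : nat -> nat, forall c M, exists2 n,
  (M <= n)%N & (#|[set k : 'I_n | T k != c]%SET| * M <= n)%N.
Proof.
(* On the block [j!, (j+1)!) the value is the 2-adic valuation of j: each value
   occurs on infinitely many blocks, and a block dwarfs all that precede it. *)
pose stage k := (\max_(j < k.+1 | j`! <= k) j)%N.
have stageE j k : (j`! <= k < j.+1`!)%N -> stage k = j.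
  case/andP=> jk kj.
  have jlt : (j < k.+1)%N by rewrite ltnS (leq_trans (fact_geq j)).
  apply/eqP; rewrite eqn_leq /stage; apply/andP; split.
    apply/bigmax_leqP => i ik; rewrite leqNgt; apply/negP => ji.
    have : (j.+1`! <= i`!)%N by exact: leq_fact ji.
    by lia.
  exact: (@leq_bigmax_cond _ (fun i : 'I_k.+1 => i`! <= k)%N _ (Ordinal jlt)).
exists (fun k => logn 2 (stage k)) => c M.
(* The odd cofactor makes the valuation exactly [c] and gives [M <= j]. Below (j+1)!, other values
   occur only before j!, a proportion of at most 1/(j+1). *)
pose j := (2 ^ c * (2 * M + 1))%N.
have jM : (M <= j)%N by rewrite /j; have := expn_gt0 2 c; nia.
have vj : logn 2 j = c.
  rewrite /j lognM ?expn_gt0 ?addn1 // pfactorK // lognE /=.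
  by rewrite dvdn2 /= oddM /= addn0.
have fj : (j < j.+1`!)%N.
  by rewrite factS; have := fact_gt0 j; nia.
exists j.+1`!; first by lia.
have : (#|[set k : 'I_(j.+1`!) | logn 2 (stage k) != c]%SET| <= j`!)%N.
  have le : (j`! <= j.+1`!)%N by exact/leq_fact.
  rewrite -[X in (_ <= X)%N](card_ord j`!).
  rewrite -(card_imset predT (f := widen_ord le)); last first.
    by move=> x y /(congr1 val) /= h; apply: val_inj.
  apply: subset_leq_card; apply/fintype.subsetP => k; rewrite inE => hk.
  have kj : (k < j`!)%N.
    rewrite ltnNge; apply/negP => jk; move: hk.
    by rewrite (stageE j) ?vj ?eqxx // jk /=.
  by apply/imsetP; exists (Ordinal kj) => //; apply: val_inj.
move=> h; rewrite factS mulnC; apply: leq_mul h; exact: leqW.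
Qed.

(** * Admissible sequences coding bit sequences *)

Lemma walk_of_expmx (m : nat) (A : 'M[nat]_m) (i j : 'I_m) (k : nat) :
  transition_matrix A -> (0 < (A ^+ k) i j)%N ->
  exists q : seq 'I_m, [/\ size q = k, path (fun i j => A i j == 1%N) i q
    & last i q = j].
Proof.
case=> A01 _ _; elim: k i => [|k IH] i.
  rewrite expr0 -[1]/(1%:M) mxE; case: eqP => // -> _.
  by exists [::].
rewrite exprS -[A * _]/(A *m _) mxE lt0n sum_nat_eq0 negb_forall.
case/existsP=> l /=; rewrite -lt0n.
rewrite -[_ * _]/(A i l * (A ^+ k) l j)%N muln_gt0 => /andP[Ail /IH[q [sq pq lq]]].
exists (l :: q); split => /=; [by rewrite sq| |by []].
by rewrite pq andbT; case: (A01 i l) Ail => ->.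
Qed.

Lemma two_successors (m : nat) (A : 'M[nat]_m) (i : 'I_m) :
  transition_matrix A -> (2 <= \sum_j A i j)%N ->
  exists j1 j2, [/\ j1 != j2, A i j1 = 1%N & A i j2 = 1%N].
Proof.
case=> A01 _ _.
have -> : (\sum_j A i j)%N = #|[set j | A i j == 1%N]%SET|.
  rewrite -sum1_card (bigID (fun j => A i j == 1%N)) /=.
  rewrite [X in (_ + X)%N]big1; last first.
    by move=> j; case: (A01 i j) => ->.
  rewrite addn0; apply: eq_big => [j|j /eqP //]; by rewrite inE.
case/card_gt1P => j1 [j2 [h1 h2 h]]; exists j1, j2.
by move: h1 h2; rewrite !inE => /eqP ? /eqP ?.
Qed.

(** [T] is the schedule: value 0 asks for an excerpt of [a], value [c.+1] for bit [c]. The times [p]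
    are chosen before [s], so that all coded orbits are sampled simultaneously. *)
Lemma admissible_coding (m : nat) (A : 'M[nat]_m) (a : nat -> 'I_m) (T : nat -> nat) :
  transition_matrix A -> irreducible_mx A ->
  (exists i0 : 'I_m, (2 <= \sum_j A i0 j)%N) -> symbol_space A a ->
  exists (p : nat -> nat) (b : (nat -> bool) -> nat -> 'I_m) (j1 j2 : 'I_m),
  [/\ increasing_seq p, forall k, (0 < p k)%N, j1 != j2,
      forall s, symbol_space A (b s) &
      forall s k, if T k is c.+1 then b s (p k) = if s c then j1 else j2
                  else forall i, (i <= k)%N -> b s (p k + i)%N = a i].
Proof.
move=> tA irrA [i0 Ai0] aA.
have [j1 [j2 [j12 A1 A2]]] := two_successors tA Ai0.
pose e : rel 'I_m := fun i j => A i j == 1%N.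
have walk i j : exists q, [/\ (0 < size q)%N, path e i q & last i q = j].
  have [k k1 /(walk_of_expmx tA)[q [sq pq lq]]] := irrA i j.
  by exists q; rewrite sq.
have [q1 [_ pq1 lq1]] := walk j1 i0.
have [q2 [_ pq2 lq2]] := walk j2 i0.
have [q0 [q0_gt0 pq0 lq0]] := walk i0 (a 0%N).
have /choice[r rP] : forall k, exists q,
    [/\ (0 < size q)%N, path e (a k) q & last (a k) q = i0].
  by move=> k; exact: walk.
pose segment k := [seq a i.+1 | i <- iota 0 k].
have psegment k : path e (a 0%N) (segment k) /\ last (a 0%N) (segment k) = a k.
  elim: k => [//|k [IHp IHl]].
  rewrite /segment -addn1 iotaD map_cat cat_path last_cat -/(segment k) /=.
  by rewrite IHp IHl /= add0n /e aA eqxx addn1.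
pose w (s : nat -> bool) k := if T k is c.+1 then
    (if s c then (j1 :: q1) ++ (j2 :: q2) else (j2 :: q2) ++ (j1 :: q1))
  else q0 ++ segment k ++ r k.
(* Both orders of the two loops have the same total length, so the arbitrary choice [xpredT] gives
   the length for every [s]. *)
pose len k := size (w xpredT k).
have szw s k : size (w s k) = len k.
  by rewrite /len /w; case: (T k) => // c; case: ifP => // _; rewrite !size_cat addnC.
have pw s k : path e i0 (w s k).
  rewrite /w; case: (T k) => [|c].
    have [ps ls] := psegment k; have [_ pr _] := rP k.
    by rewrite !cat_path pq0 lq0 ps ls.
  by case: ifP => _; rewrite cat_path /= pq1 pq2 ?lq1 ?lq2 /e A1 A2.
have lw s k : last i0 (w s k) = i0.
  rewrite /w; case: (T k) => [|c].
    have [ps ls] := psegment k; have [_ _ lr] := rP k.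
    by rewrite !last_cat lq0 ls.
  by case: ifP => _; rewrite last_cat /= ?lq1 ?lq2.
(* The sampled letter is the last one of [q0], which is [a 0], or the first one of a bit block,
   which is [j1] or [j2]. *)
pose off k := if T k is c.+1 then 0%N else (size q0).-1.
have off_lt k : (off k < len k)%N.
  rewrite /off /len /w; case: (T k) => [|c] //=; rewrite size_cat; lia.
have len_gt0 k : (0 < len k)%N by have := off_lt k; lia.
have /choice[b bP] : forall s, exists b, (forall n, e (b n) (b n.+1)) /\
    forall k j, (j < len k)%N ->
      b (\sum_(l < k) len l + j).+1 = nth i0 (w s k) j.
  move=> s.
  by have [b] := concat_words len_gt0 (szw s) (pw s) (lw s); exists b.
exists (fun k => (\sum_(l < k) len l + off k).+1), b, j1, j2; split => //.
- apply/increasing_seqP => k; rewrite big_ord_recr ltEnat /=.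
  by have := off_lt k; lia.
- by move=> s n; have [/(_ n)/eqP] := bP s.
move=> s k; have [_ bk] := bP s; case Tk: (T k) => [|c].
  move=> i ik; rewrite addSn -addnA bk; last first.
    by rewrite /off /len /w Tk !size_cat size_map size_iota; have [] := rP k; lia.
  rewrite /off /w Tk nth_cat.
  case: i ik => [|i] ik.
    by rewrite addn0 ifT ?ltn_predL // nth_last -lq0; case: (q0) q0_gt0.
  rewrite ifF; last by lia.
  rewrite nth_cat size_map size_iota ifT; last by lia.
  rewrite (nth_map 0%N) ?size_iota; last by lia.
  rewrite nth_iota; last by lia.
  congr a; lia.
by rewrite bk // /off /w Tk; case: ifP.
Qed.

(** * Cantor's diagonal argument and limits of frequencies *)

(** For injective [h], the diagonal sequence [d] would differ from each [s] at index [h s], hence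
    from itself. *)
Lemma bool_seq_not_injective (h : (nat -> bool) -> nat) : ~ injective h.
Proof.
move=> h_inj; pose d n := ~~ `[< exists s, h s = n /\ s n >].
have := erefl (d (h d)); rewrite {1}/d; case: asboolP => /=.
  by move=> [s [/h_inj -> ->]].
by move=> hd dd; apply: hd; exists d.
Qed.

(** The hypotheses force every tail infimum to equal [l], so the sequence of infima is constant. *)
Lemma limn_inf_eq (R : realType) (u : nat -> R) (l : R) :
  (forall n, l <= u n) ->
  (forall e N, 0 < e -> exists2 n, (N <= n)%N & u n < l + e) ->
  limn_inf u = l.
Proof.
move=> lu ul; rewrite /limn_inf.
suff -> : infs u = fun=> l by exact: lim_cst.
apply/funext => N; apply/eqP; rewrite eq_le /infs /=; apply/andP; split.
  apply/ler_addgt0Pr => e e0; have [n Nn un] := ul e N e0.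
  apply: le_trans (ltW un); apply: ge_inf.
    by exists l => _ [k _ <-].
  by exists n.
apply: lb_le_inf; first by exists (u N), N => //=.
by move=> _ [k _ <-].
Qed.

Lemma limn_sup_eq (R : realType) (u : nat -> R) (l : R) :
  (forall n, u n <= l) ->
  (forall e N, 0 < e -> exists2 n, (N <= n)%N & l - e < u n) ->
  limn_sup u = l.
Proof.
move=> ul lu; rewrite /limn_sup.
suff -> : sups u = fun=> l by exact: lim_cst.
apply/funext => N; apply/eqP; rewrite eq_le /sups /=; apply/andP; split.
  apply: ge_sup; first by exists (u N), N => //=.
  by move=> _ [k _ <-].
apply/ler_addgt0Pr => e e0; have [n Nn un] := lu e N e0.
rewrite -lerBlDr; apply: le_trans (ltW un) _; apply: ub_le_sup.
  by exists l => _ [k _ <-].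
by exists n.
Qed.

(** * Itineraries in a compact space *)

(** Any cluster point of [x] works, since each [C n] is closed and contains a tail of [x]. *)
Lemma compact_nested_closed (X : topologicalType) (C : nat -> set X)
    (x : nat -> X) :
  compact [set: X] -> (forall n, closed (C n)) ->
  (forall n N, (n <= N)%N -> C n (x N)) -> exists p, forall n, C n p.
Proof.
move=> cX clC Cx.
have [p [_ pC]] := cX (x n @[n --> \oo]) _ filterT.
exists p => n; apply: clC => B pB.
apply: pC => //; exists n => // N /= nN; exact: Cx.
Qed.

Lemma closed_itinerary (R : realType) (X : metricType R) (f : X -> X)
    (U : set X) (n : nat) :
  continuous f -> compact U -> closed (iter n f @^-1` U).
Proof.
move=> cf cU; apply: closed_comp; last exact: (compact_closed (@metric_hausdorff _ _) cU).
move=> x _; elim: n x => [|n IH] x; first exact: cvg_id.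
by apply: (@continuous_comp _ _ _ (iter n f) f); [exact: IH|exact: cf].
Qed.

Lemma itinerary_nonempty (R : realType) (X : metricType R) (m : nat)
    (f : X -> X) (A : 'M[nat]_m) (V : 'I_m -> set X) (b : nat -> 'I_m) :
  compact [set: X] -> continuous f -> (forall i, compact (V i)) ->
  coupled_expanding f A V -> symbol_space A b ->
  itinerary_set f V b !=set0.
Proof.
move=> cX cf cV [V0 _ fV] bA.
(* Finite itineraries are realized by pulling back along the covering relation; the claim ranges
   over all [b] because the induction passes to the shifted sequence. *)
have finite N : forall b, symbol_space A b ->
    exists x, forall n, (n <= N)%N -> V (b n) (iter n f x).
  elim: N => [|N IH] {bA}b bA.
    by have [x Vx] := V0 (b 0%N); exists x => n; rewrite leqn0 => /eqP ->.
  have [y Vy] := IH (fun n => b n.+1) (fun n => bA n.+1).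
  have [x Vx fx] : (f @` V (b 0%N)) y.
    by apply: fV; exists (b 1%N); [exact: bA|exact: (Vy 0%N)].
  by exists x => -[//|n] nN; rewrite iterSr fx; exact: Vy.
have /choice[x Vx] := fun N => finite N b bA.
have [p Vp] := compact_nested_closed cX
  (fun n => closed_itinerary (n := n) cf (cV (b n))) (fun n N => Vx N n).
by exists p => n _; exact: Vp.
Qed.

(** Otherwise points following [a] ever longer while staying away from [z] would accumulate at a
    second point of the singleton. *)
Lemma itinerary_shadowing (R : realType) (X : metricType R) (m : nat)
    (f : X -> X) (V : 'I_m -> set X) (a : nat -> 'I_m) (z : X) (e : R) :
  compact [set: X] -> continuous f -> (forall i, compact (V i)) ->
  itinerary_set f V a = [set z] -> 0 < e ->
  exists r, forall x, (forall n, (n <= r)%N -> V (a n) (iter n f x)) ->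
    mdist z x < e.
Proof.
move=> cX cf cV az e0; apply/not_existsP => far.
have /choice[x xP] : forall r, exists x,
    (forall n, (n <= r)%N -> V (a n) (iter n f x)) /\ ~ mdist z x < e.
  move=> r; have /existsNP[x /not_implyP xr] := far r.
  by exists x.
have clC n : closed (iter n f @^-1` V (a n) `&` ~` (ball z e)°).
  apply: closedI; first exact: closed_itinerary.
  by apply: open_closedC; exact: open_interior.
have xC n N : (n <= N)%N -> (iter n f @^-1` V (a n) `&` ~` (ball z e)°) (x N).
  have [xV far_x] := xP N; split; first exact: xV.
  by move=> /interior_subset; rewrite ballEmdist.
have [p pC] := compact_nested_closed cX clC xC.
have : itinerary_set f V a p by move=> n _; have [] := pC n.
rewrite az => /= pz; have [_ []] := pC 0%N.
by rewrite pz; exact: nbhsx_ballx.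
Qed.

(** * Distribution functions from densities of times *)

Lemma mdist_ge_set_dist (R : realType) (X : metricType R) (U V : set X)
    (x y : X) : U x -> V y -> set_dist U V <= mdist x y.
Proof.
move=> Ux Vy; apply: ge_inf; last by exists x => //; exists y.
by exists 0 => _ [u _ [v _ <-]]; exact: mdist_ge0.
Qed.

Lemma proximity_freq_ge0 (R : realType) (X : metricType R) (f : X -> X)
    (p : nat -> nat) (x y : X) (t : R) (n : nat) :
  0 <= proximity_freq f p x y t n.
Proof. by rewrite /proximity_freq divr_ge0. Qed.

Lemma proximity_freq_le1 (R : realType) (X : metricType R) (f : X -> X)
    (p : nat -> nat) (x y : X) (t : R) (n : nat) :
  proximity_freq f p x y t n <= 1.
Proof.
rewrite /proximity_freq; case: n => [|n]; first by rewrite invr0 mulr0.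
by rewrite ler_pdivrMr ?ltr0n // mul1r ler_nat -[X in (_ <= X)%N]card_ord max_card.
Qed.

(** [E] contains all times of proximity and fills an arbitrarily small part of suitable initial
    segments. *)
Lemma lower_dist_eq0 (R : realType) (X : metricType R) (f : X -> X)
    (p : nat -> nat) (x y : X) (t : R) (E : pred nat) :
  (forall k, ~~ E k -> t <= mdist (iter (p k) f x) (iter (p k) f y)) ->
  (forall M, exists2 n, (M <= n)%N & (#|[set k : 'I_n | E k]%SET| * M <= n)%N) ->
  lower_dist f p x y t = 0.
Proof.
move=> Et dE; apply: limn_inf_eq => [n|e N e0]; first exact: proximity_freq_ge0.
(* Chosen so that [1 / M < e]. *)
pose M := (Num.truncn e^-1).+1.
have eM : 1 < e * M%:R.
  by rewrite -ltr_pdivrMl // mulr1 truncnS_gt.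
have [n Mn dn] := dE (N + M)%N.
exists n; first by rewrite (leq_trans _ Mn) ?leq_addr.
have n0 : (0 < n)%N by rewrite (leq_trans _ Mn) // addnS.
rewrite add0r /proximity_freq ltr_pdivrMr ?ltr0n //.
set c := #|_|%:R.
have cM : c * M%:R <= n%:R.
  rewrite /c -natrM ler_nat; apply: leq_trans dn; apply: leq_mul; last exact: leq_addl.
  apply: subset_leq_card; apply/fintype.subsetP => k; rewrite !inE => xy.
  by apply: contraLR xy => /Et; rewrite -leNgt.
have M0 : 0 < M%:R :> R by rewrite ltr0n.
rewrite -(ltr_pM2r M0) mulrAC; apply: le_lt_trans cM _.
by rewrite ltr_pMl ?ltr0n.
Qed.

Lemma upper_dist_eq1 (R : realType) (X : metricType R) (f : X -> X)
    (p : nat -> nat) (x y : X) (t : R) (E : pred nat) (r : nat) :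
  (forall k, (r <= k)%N -> ~~ E k ->
     mdist (iter (p k) f x) (iter (p k) f y) < t) ->
  (forall M, exists2 n, (M <= n)%N & (#|[set k : 'I_n | E k]%SET| * M <= n)%N) ->
  upper_dist f p x y t = 1.
Proof.
move=> Et dE; apply: limn_sup_eq => [n|e N e0]; first exact: proximity_freq_le1.
pose M := (Num.truncn e^-1).+1.
have eM : 1 < e * M%:R.
  by rewrite -ltr_pdivrMl // mulr1 truncnS_gt.
(* The factor 2 splits the error: the exceptional set [E] and the first [r] times each have at most
   [n / (2 * M)] elements. *)
have [n Mn dn] := dE (N + 2 * M * r.+1)%N.
exists n; first by rewrite (leq_trans _ Mn) ?leq_addr.
have n0 : (0 < n)%N by rewrite (leq_trans _ Mn) // /M; lia.
rewrite /proximity_freq ltr_pdivlMr ?ltr0n // mulrBl mul1r ltrBlDl.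
set S := [set k : 'I_n | _]%SET.
rewrite -[X in X%:R < _](card_ord n) -(cardsC S) natrD addrC ltrD2r.
have ltr : (#|[set k : 'I_n | k < r]%SET| <= r)%N.
  rewrite -[X in (_ <= X)%N](card_ord r) -[X in (_ <= X)%N]cardsT.
  have [rn|/ltnW nr] := leqP r n.
    apply: leq_trans (leq_imset_card (widen_ord rn) _).
    apply: subset_leq_card; apply/fintype.subsetP => k; rewrite inE => kr.
    by apply/imsetP; exists (Ordinal kr) => //; exact: val_inj.
  by rewrite cardsT card_ord (leq_trans (max_card _)) ?card_ord.
have cS : (#|~: S| <= #|[set k : 'I_n | E k]%SET| + r)%N.
  apply: leq_trans (leq_add (leqnn _) ltr); apply: leq_trans (leq_card_setU _ _).
  apply: subset_leq_card; apply/fintype.subsetP => k; rewrite !inE => xy.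
  case: (boolP (E k)) => //= Ek.
  by rewrite ltnNge; apply: contra xy => rk; exact: Et.
have cM : (#|~: S| * M <= n)%N by nia.
have M0 : 0 < M%:R :> R by rewrite ltr0n.
rewrite -(ltr_pM2r M0) mulrAC -natrM.
apply: (@le_lt_trans _ _ n%:R); first by rewrite ler_nat.
by rewrite ltr_pMl ?ltr0n.
Qed.

(** * The chaotic set of coded points *)

Theorem theorem3p1 (R : realType) (X : metricType R) (m : nat)
    (f : X -> X) (A : 'M[nat]_m) (V : 'I_m -> set X) :
  compact [set: X] ->
  (2 <= m)%N ->
  continuous f ->
  transition_matrix A ->
  irreducible_mx A ->
  (exists i0 : 'I_m, (2 <= \sum_j A i0 j)%N) ->
  (forall i, compact (V i)) ->
  strictly_coupled_expanding f A V ->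
  (exists2 a : nat -> 'I_m,
     symbol_space A a & exists x : X, itinerary_set f V a = [set x]) ->
  exists p : nat -> nat,
    [/\ increasing_seq p, forall k, (0 < p k)%N & dist_chaotic f p].
Proof.
move=> cX _ cf tA irrA Ai0 cV [ceV sep] [a aA [z az]].
have [T dT] := exists_dense_values.
have [p [b [j1 [j2 [p_incr p_gt0 j12 bA bT]]]]] := admissible_coding T tA irrA Ai0 aA.
exists p; split => //.
have /choice[x xP] := fun s => itinerary_nonempty cX cf cV ceV (bA s).
have xV s n : V (b s n) (iter n f (x s)) by exact: xP.
have e0 := sep _ _ j12; set e := set_dist _ _ in e0.
have far s s' c k : s c != s' c -> T k = c.+1 ->
    e <= mdist (iter (p k) f (x s)) (iter (p k) f (x s')).
  move=> ss' Tk; have := xV s (p k); have := xV s' (p k).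
  have := bT s k; have := bT s' k; rewrite Tk => -> ->.
  case: (s c) (s' c) ss' => -[] // _ V1 V2; last rewrite metric_sym.
    exact: mdist_ge_set_dist.
  exact: mdist_ge_set_dist.
have neq_bit (s s' : nat -> bool) : s <> s' -> exists c, s c != s' c.
  move=> ss'; apply: contrapT => /forallNP h; apply: ss'; apply/funext => c.
  by apply/eqP/negPn/negP; exact: h.
(* Injectivity transfers uncountability from bit sequences to the range of [x]: a differing bit is
   sampled at some time, where the orbits are apart. *)
have x_inj : injective x.
  move=> s s' xx; apply: contrapT => /neq_bit[c sc].
  (* If [c.+1] were never a value of [T], all [n] indices would be exceptional, giving [n * 2 <= n]
     with [n >= 2]. *)
  have [n n1 dn] := dT c.+1 2%N.
  have [k /eqP Tk] : exists k, T k == c.+1.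
    apply: contrapT => /forallNP h; move: dn.
    suff -> : [set k : 'I_n | T k != c.+1]%SET = [set: 'I_n]%SET.
      by rewrite cardsT card_ord; lia.
    by apply/setP => k; rewrite !inE; apply/negP; exact: h.
  by have := far s s' c k sc Tk; rewrite xx mdistxx leNgt e0.
exists (range x).
  move=> /countable_injP[h h_inj]; apply: (@bool_seq_not_injective (h \o x)).
  by move=> s s' hs; apply/x_inj/h_inj => //; apply/mem_set; [exists s|exists s'].
move=> _ _ [s _ <-] [s' _ <-] xx; split => [|t t0].
  have [c sc] : exists c, s c != s' c 
    by apply: neq_bit => ss'; apply: xx; rewrite ss'.
  exists e => //; apply: (@lower_dist_eq0 _ _ _ _ _ _ _ (fun k => T k != c.+1)).
    by move=> k /negPn/eqP; exact: far.
  exact: dT.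
have t2 : 0 < t / 2 by rewrite divr_gt0.
have [r rP] := itinerary_shadowing cX cf cV az t2.
(* From time [p k] on, the orbit of [x u] follows [a] up to step [k >= r], so shadowing applies; two
   such orbits are then within [t] of each other through [z]. *)
have near u k : (r <= k)%N -> T k = 0%N -> mdist z (iter (p k) f (x u)) < t / 2.
  move=> rk Tk; apply: rP => n nr; rewrite -iterD addnC.
  have := bT u k; rewrite Tk => <-; last exact: leq_trans rk.
  exact: xV.
apply: (@upper_dist_eq1 _ _ _ _ _ _ _ (fun k => T k != 0%N) r); last exact: dT.
move=> k rk /negPn/eqP Tk.
rewrite (le_lt_trans (metric_triangle _ z _)) // metric_sym [t]splitr.
by rewrite ltrD ?near.
Qed.
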